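(* Every natural function $f \in \mathcal{F}_{Natural}$ is either constant or strictly increasing on $\mathbb{I}$.
   Context: Let $\mathbb{I}=\{1,2,3,\ldots\}$ be the set of non-zero positive integers, and let $\mathcal{F}$ be the set of all functions from $\mathbb{I}$ to $\mathbb{I}$. For $f,g\in\mathcal{F}$, the functions $f+g$, $f\times g$, $f\wedge g$ are defined pointwise, where $\wedge$ is exponentiation: $(f\wedge g)(n)=f(n)^{g(n)}$. Let $\mathcal{F}_s\subset\mathcal{F}$ be the set consisting of the identity map $n\mapsto n$ and all constant maps $n\mapsto a$ with $a\in\mathbb{I}$. For a subset $P\subset\mathcal{F}$ and an operation $*\in\{+,\times,\wedge\}$ put $A_*(P)=P\cup\{f\in\mathcal{F}\mid \exists g\in P,\ \exists h\in P,\ f=g*h\}$. Let $\Sigma$ be the set of all finite words in the letters $A_+,A_\times,A_\wedge$ (each word acting on subsets of $\mathcal{F}$ by composition). The set of natural functions is $\mathcal{F}_{Natural}=\bigcup_{\sigma\in\Sigma}\sigma(\mathcal{F}_s)$. *)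

(* Defs.v *)
From Stdlib Require Import PArith List Ensembles.

Local Open Scope positive_scope.

Definition posfun : Type := positive -> positive.

Inductive operation : Set := Plus | Times | Power.

Definition op_eval (o : operation) : positive -> positive -> positive :=
  match o with
  | Plus => Pos.add
  | Times => Pos.mul
  | Power => Pos.pow
  end.

Definition fun_op (o : operation) (f g : posfun) : posfun :=
  fun n => op_eval o (f n) (g n).

Definition constant (f : posfun) : Prop :=
  exists a : positive, forall n : positive, f n = a.

Definition strictly_increasing (f : posfun) : Prop :=
  forall m n : positive, m < n -> f m < f n.

(* Equality of functions is taken pointwise here and in [adjoin], so that
   these sets do not depend on functional extensionality. *)
Definition simple_functions : Ensemble posfun :=
  fun f => (forall n : positive, f n = n) \/ constant f.

Definition adjoin (o : operation) (P : Ensemble posfun) : Ensemble posfun :=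
  Union posfun P
    (fun f => exists g : posfun, In posfun P g /\
              exists h : posfun, In posfun P h /\
              forall n : positive, f n = fun_op o g h n).

(* The leftmost letter of a word is applied last. *)
Definition word_action (w : list operation) (P : Ensemble posfun) :
  Ensemble posfun := fold_right adjoin P w.

Definition natural_functions : Ensemble posfun :=
  fun f => exists w : list operation,
    In posfun (word_action w simple_functions) f.

(* Main.v *)
Require Import Defs.
From Stdlib Require Import PArith List Ensembles.
From Stdlib Require Import ZArith Lia.

(** Constant or strictly increasing functions are closed under the three
    operations.  The only exceptional case is [a ^ h] with [h] increasing, which
    is increasing for [a > 1] but constant for [a = 1]. *)

Local Open Scope positive_scope.

Lemma pos_pow_lt_mono_l (a b c : positive) : a < b -> a ^ c < b ^ c.
Proof.
  intros Hab.
  apply Pos2Z.pos_lt_pos in Hab.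
  assert (H : (Z.pos (a ^ c) < Z.pos (b ^ c))%Z).
  { rewrite !Pos2Z.inj_pow. apply Z.pow_lt_mono_l; lia. }
  (* On [Z.pos] values, [Z.lt] computes to the comparison behind [Pos.lt], so the two inequalities
     are convertible. *)
  exact H.
Qed.

Lemma pos_pow_lt_mono_r (a b c : positive) : 1 < a -> b < c -> a ^ b < a ^ c.
Proof.
  intros Ha Hbc.
  assert (H : (Z.pos (a ^ b) < Z.pos (a ^ c))%Z).
  { rewrite !Pos2Z.inj_pow. apply Z.pow_lt_mono_r; lia. }
  exact H.
Qed.

Lemma pos_pow_1_l (a : positive) : 1 ^ a = 1.
Proof.
  assert (H : Z.pos (1 ^ a) = 1%Z).
  { rewrite Pos2Z.inj_pow. apply Z.pow_1_l. lia. }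
  now injection H.
Qed.

Lemma fun_op_constant_or_increasing (o : operation) (f g h : posfun) :
  constant g \/ strictly_increasing g ->
  constant h \/ strictly_increasing h ->
  (forall n, f n = fun_op o g h n) ->
  constant f \/ strictly_increasing f.
Proof.
  unfold fun_op.
  intros [[a Ha] | Hg] [[b Hb] | Hh] Hf.
  - left. exists (op_eval o a b). intros n. now rewrite Hf, Ha, Hb.
  - destruct o; simpl in Hf.
    + right. intros m n Hmn. rewrite !Hf, !Ha. specialize (Hh m n Hmn). lia.
    + right. intros m n Hmn. rewrite !Hf, !Ha.
      apply Pos.mul_lt_mono_l, Hh, Hmn.
    + destruct (Pos.eq_dec a 1) as [-> | Ha1].
      * left. exists 1. intros n. now rewrite Hf, Ha, pos_pow_1_l.
      * right. intros m n Hmn. rewrite !Hf, !Ha.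
        apply pos_pow_lt_mono_r; [lia | apply Hh, Hmn].
  (* A constant exponent [b] is at least 1, so powers cause no exceptional case here. *)
  - right. intros m n Hmn. rewrite !Hf, !Hb. specialize (Hg m n Hmn).
    destruct o; simpl.
    + lia.
    + now apply Pos.mul_lt_mono_r.
    + now apply pos_pow_lt_mono_l.
  - right. intros m n Hmn. rewrite !Hf.
    specialize (Hg m n Hmn). specialize (Hh m n Hmn).
    destruct o; simpl.
    + lia.
    + now apply Pos.mul_lt_mono.
    (* Raise the base first, with exponent [h m] fixed, then the exponent, with base [g n] fixed. *)
    + apply Pos.lt_trans with (g n ^ h m).
      * now apply pos_pow_lt_mono_l.
      (* The base satisfies [1 < g n] because [g n] exceeds the positive number [g m]. *)
      * apply pos_pow_lt_mono_r; lia.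
Qed.

Theorem proposition1p6 (f : posfun) (hf : In posfun natural_functions f) :
  constant f \/ strictly_increasing f.
Proof.
  (* Generalising over [f] lets the induction hypothesis apply to both operands of the operation at
     the head of the word, which acts last. *)
  destruct hf as [w Hw]. revert f Hw.
  induction w as [| o w IH]; intros f Hw.
  - destruct Hw as [Hid | Hc]; [right | now left].
    intros m n Hmn. now rewrite !Hid.
  - destruct Hw as [f Hf | f (g & Hg & h & Hh & Hf)].
    + now apply IH.
    + exact (fun_op_constant_or_increasing o f g h (IH g Hg) (IH h Hh) Hf).
Qed.
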